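(* For nonzero complex numbers $a,b$ with $|a|<1$ and $|b|<1$, $$\frac{(q;q)_{\infty}^3\,(a b;q)_{\infty}}{(a;q)_{\infty}^2\,(b;q)_{\infty}^2}=\sum_{n=0}^{\infty}\left\{\frac{n\,(q / a;q)_n\, a^n}{(b;q)_{n+1}}+\frac{(n+1)\,(q / b;q)_n\, b^n}{(a;q)_{n+1}}\right\}.$$
   Context: $q$ is a complex number with $0<|q|<1$. $(a;q)_\infty=\prod_{j=0}^{\infty}(1-aq^j)$, and for an integer $n\ge 0$, $(a;q)_n=\prod_{j=0}^{n-1}(1-aq^j)$. *)

(* Defs.v *)
From HB Require Import structures.
From mathcomp Require Import all_boot all_order all_algebra.
From mathcomp Require Import all_classical all_reals all_analysis.
From mathcomp Require Import complex.

Set Implicit Arguments.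
Unset Strict Implicit.
Unset Printing Implicit Defensive.

Import Order.TTheory GRing.Theory Num.Theory.
Import numFieldNormedType.Exports.

Local Open Scope ring_scope.
Local Open Scope classical_set_scope.

(* R[i] carries no topology of its own; viewed as a numClosedFieldType it
   inherits the one of the modulus `|x|.  That modulus is an element of
   Cplx R with zero imaginary part, so `|x| < 1 is the usual comparison. *)
Definition Cplx (R : realType) : numClosedFieldType := R[i]%C.

Definition qpoch (R : realType) (a q : Cplx R) (n : nat) : Cplx R :=
  \prod_(j < n) (1 - a * q ^+ j).

(* The limit exists for every a as soon as `|q| < 1. *)
Definition qpoch_inf (R : realType) (a q : Cplx R) : Cplx R :=
  limn (qpoch a q).

(* Main.v *)
(** Let [U_n(a, b) = (q / a; q)_n a ^ n / (b; q)_(n + 1)] and let [S(a, b)] be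
    the sum of the theorem, i.e. of [n U_n(a, b) + (n + 1) U_n(b, a)].
    With [V_n = U_n(b, a)], replacing [a] by [a q] turns [(1 - a b) U_(n+1)] into
    [(1 - a) (U_(n+1) - a U_n)] and [(1 - a b) V_n] into
    [(1 - a) (V_n - a V_(n+1))], all of it at [(a, b)] on the right.  Summed over
    [n] this shows that [T(a, b) = sum_n U_n(a, b) - sum_n U_n(b, a)]
    satisfies [(1 - a b) T(a q, b) = (1 - a)^2 T(a, b)], and that so does [S]
    once [T = 0] is known.  Since [T(b, a) = - T(a, b)], and [S] is symmetric
    because [T = 0], iterating in both variables down to [(0, 0)] gives
    [S(a, b) (a; q)_oo^2 (b; q)_oo^2 = (a b; q)_oo S(0, 0)], and likewise for
    [T], where [T(0, 0) = 0].  At [a = b = q] a single term of [S] is nonzero,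
    which determines [S(0, 0) = (q; q)_oo^3]. *)

Require Import Defs.
From mathcomp Require Import all_boot all_order all_algebra.
From mathcomp Require Import all_classical all_reals all_analysis.
From mathcomp Require Import complex.
From mathcomp Require Import ring.

Import Order.TTheory GRing.Theory Num.Theory.
Import numFieldNormedType.Exports.

Local Open Scope ring_scope.
Local Open Scope classical_set_scope.

(** * Geometrically bounded complex series *)

Section ComplexSeries.
Context {R : realType}.
Local Notation C := (Cplx R).
Implicit Types (t : R) (u v : nat -> C) (c e r s x y z : C).

(** The inclusion of the reals, with values typed in [Cplx R] so that its order and topology
    apply. *)
Definition toC : R -> C := fun t => Complex t 0.

(** The order of [Cplx R] compares only numbers with equal imaginary part, so a nonnegative complex
    bound or radius is a real one. *)
Lemma ge0_toC z : 0 <= z -> z = toC (complex.Re z).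
Proof. by rewrite lecE /=; case: z => a b /= /andP[/eqP -> _]. Qed.

Lemma toCX t n : toC (t ^+ n) = toC t ^+ n.
Proof. exact: (rmorphXn (real_complex R)). Qed.

Lemma toCM t t' : toC (t * t') = toC t * toC t'.
Proof. exact: (rmorphM (real_complex R)). Qed.

Lemma toCD t t' : toC (t + t') = toC t + toC t'.
Proof. exact: (rmorphD (real_complex R)). Qed.

Lemma toCB t t' : toC (t - t') = toC t - toC t'.
Proof. exact: (rmorphB (real_complex R)). Qed.

Lemma le_toC t t' : (toC t <= toC t') = (t <= t').
Proof. exact: lecR. Qed.

Lemma lt_toC t t' : (toC t < toC t') = (t < t').
Proof. exact: ltcR. Qed.

Lemma normCE z : `|z| = toC (Num.sqrt (complex.Re z ^+ 2 + complex.Im z ^+ 2)).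
Proof. exact: normc_def. Qed.

Lemma norm_toC t : `|toC t| = toC `|t|.
Proof. by rewrite normCE/= expr0n addr0 sqrtr_sqr. Qed.

Lemma norm_Re_le z : toC `|complex.Re z| <= `|z|.
Proof. by rewrite normCE le_toC -sqrtr_sqr ler_wsqrtr// lerDl sqr_ge0. Qed.

Lemma norm_Im_le z : toC `|complex.Im z| <= `|z|.
Proof. by rewrite normCE le_toC -sqrtr_sqr ler_wsqrtr// lerDr sqr_ge0. Qed.

Lemma cvg_toC (f : nat -> R) t : f @ \oo --> t -> (toC \o f) @ \oo --> toC t.
Proof.
move=> /cvgrPdist_lt ft; apply/cvgrPdist_lt => e e0.
have ee : e = toC (complex.Re e) by exact/ge0_toC/ltW.
have e'0 : 0 < complex.Re e by rewrite -lt_toC -ee.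
have := ft _ e'0; apply: filterS => n /=.
by rewrite -toCB norm_toC [X in _ < X -> _]lock [X in _ -> _ < X]ee -lock lt_toC.
Qed.

Lemma cvg_ReIm u (a b : R) :
  (fun n => complex.Re (u n)) @ \oo --> a -> (fun n => complex.Im (u n)) @ \oo --> b ->
  u @ \oo --> (Complex a b : C).
Proof.
move=> /cvg_toC ua /cvg_toC ub.
have E (x y : R) : (Complex x y : C) = toC x + Complex 0 1 * toC y.
  by apply/eqP; rewrite eq_complex /= !(mul0r, mulr0, mul1r, addr0, add0r, subr0) !eqxx.
have -> : u = (toC \o (fun n => complex.Re (u n)))
    \+ (cst (Complex 0 1 : C) \* (toC \o (fun n => complex.Im (u n)))).
  by apply/funext => n /=; rewrite -E; case: (u n).
rewrite (E a b).
exact: (cvgD ua (cvgM (cvg_cst (Complex 0 1 : C)) ub)).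
Qed.

Lemma cvg_expC s : `|s| < 1 -> (fun n => s ^+ n) @ \oo --> (0 : C).
Proof.
move=> s1; apply/cvgr0Pnorm_lt => e e0.
have E : `|s| = toC (complex.Re `|s|) by exact: ge0_toC.
have r1 : `|complex.Re `|s| | < 1.
  have r0 : 0 <= complex.Re `|s| by rewrite -le_toC -E; exact: normr_ge0.
  by rewrite (ger0_norm r0) -lt_toC -E; exact: s1.
have := cvg_toC _ _ (cvg_expr r1); move/cvgr0Pnorm_lt => /(_ e e0).
apply: filterS => n /=.
by rewrite toCX -E !normrX normr_id.
Qed.

Definition geo_bounded c s u := forall n, `|u n| <= c * s ^+ n.

(** Real and imaginary parts are each dominated by a real geometric series, hence converge
    absolutely; [cvg_ReIm] reassembles the complex limit. *)
Lemma cvg_series_geo c s u : 0 <= c -> 0 <= s -> s < 1 -> geo_bounded c s u ->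
  cvgn (series u).
Proof.
move=> c0 s0 s1 us.
have cE := ge0_toC _ c0; have sE := ge0_toC _ s0.
have r0 : 0 <= complex.Re s by rewrite -le_toC -sE.
have c'0 : 0 <= complex.Re c by rewrite -le_toC -cE.
have r1 : `|complex.Re s| < 1 by rewrite ger0_norm// -lt_toC -sE.
have H (p : C -> R) : (forall z, toC `|p z| <= `|z|) -> cvgn (series (p \o u)).
  move=> pz; apply: normed_cvg.
  apply: (series_le_cvg _ _ _ (is_cvg_geometric_series (a := complex.Re c) r1)) => n /=.
  - by [].
  - by rewrite mulr_ge0// exprn_ge0.
  - by rewrite -le_toC toCM toCX -cE -sE (le_trans (pz _))// us.
apply/cvg_ex; exists (Complex (limn (series ((fun n => complex.Re (u n)))))
   (limn (series ((fun n => complex.Im (u n))))) : C).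
have SE (p : C -> R) : {morph p : x y / x + y} -> p 0 = 0 ->
    (fun n => p (series u n)) = series (p \o u).
  by move=> pD p0; apply/funext => n; rewrite /series/= (big_morph _ pD p0).
apply: cvg_ReIm.
- rewrite (SE (@complex.Re R))//; first exact/(H (@complex.Re R))/norm_Re_le.
  by case=> ? ? [].
- rewrite (SE (@complex.Im R))//; first exact/(H (@complex.Im R))/norm_Im_le.
  by case=> ? ? [].
Qed.
End ComplexSeries.

(** * Tail estimates and termwise limits of series *)

Section Tannery.
Context {R : realType}.
Local Notation C := (Cplx R).
Implicit Types (u v w g : nat -> C) (f : nat -> nat -> C) (c e r s t x y z : C).

Lemma geo_series_tail c s u m n : 0 <= c -> 0 <= s -> s < 1 ->
    geo_bounded c s u -> (m <= n)%N ->
  `|series u n - series u m| <= c * s ^+ m / (1 - s).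
Proof.
move=> c0 s0 s1 us mn.
have d0 : 0 < 1 - s by rewrite subr_gt0.
(* The exact finite geometric sum makes the induction go through; dropping [s ^+ (m + k)] then gives
   the bound. *)
suff H k : `|series u (m + k)%N - series u m| <= c * (s ^+ m - s ^+ (m + k)) / (1 - s).
  rewrite -(subnKC mn) (le_trans (H _))// ler_pM2r ?invr_gt0// ler_wpM2l//.
  by rewrite gerBl exprn_ge0.
elim: k => [|k IH]; first by rewrite addn0 !subrr normr0 mulr0 mul0r.
have -> : series u (m + k.+1)%N - series u m = series u (m + k)%N - series u m + u (m + k)%N.
  by rewrite addnS -(seriesSB u (m + k)%N); ring.
have -> : c * (s ^+ m - s ^+ (m + k.+1)) / (1 - s)
   = c * (s ^+ m - s ^+ (m + k)) / (1 - s) + c * s ^+ (m + k).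
  by rewrite addnS exprS; field; rewrite lt0r_neq0.
by rewrite (le_trans (ler_normD _ _))// lerD.
Qed.

Lemma geo_lim_tail c s u m : 0 <= c -> 0 <= s -> s < 1 -> geo_bounded c s u ->
  `|limn (series u) - series u m| <= c * s ^+ m / (1 - s).
Proof.
move=> c0 s0 s1 us; apply/ler_addgt0Pr => e e0.
have /cvgrPdist_lt/(_ _ e0) ue := cvg_series_geo _ _ _ c0 s0 s1 us.
have [n [nm ne]] := @filter_ex _ _ _ _ (filterI (nbhs_infty_ge m) ue).
rewrite -(subrK (series u n) (limn _)) -addrA addrC (le_trans (ler_normD _ _))//.
by rewrite lerD ?(ltW ne)//; exact: geo_series_tail.
Qed.

Lemma cvg_series_partial f g m : (forall n, f^~ n @ \oo --> g n) ->
  (fun k => series (f k) m) @ \oo --> series g m.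
Proof.
move=> fg; elim: m => [|m IH].
  have E v : series v 0 = 0 by rewrite /series/= big_geq.
  by under eq_fun do rewrite E; rewrite E; exact: cvg_cst.
have E v : series v m.+1 = series v m + v m by rewrite -(seriesSB v m) addrC subrK.
by under eq_fun do rewrite E; rewrite E; exact: (cvgD IH (fg m)).
Qed.

(** Dominated convergence for series: the common geometric bound allows a cut at an [m] where both
    tails are below [e / 3] for every [k], and the finite sum up to [m] converges termwise. *)
Lemma tannery c s f g : 0 <= c -> 0 <= s -> s < 1 ->
  (forall k, geo_bounded c s (f k)) -> geo_bounded c s g ->
  (forall n, f^~ n @ \oo --> g n) ->
  (fun k => limn (series (f k))) @ \oo --> limn (series g).
Proof.
move=> c0 s0 s1 fs gs fg; apply/cvgrPdist_lt => e e0.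
have d0 : 0 < 1 - s by rewrite subr_gt0.
have e3 : 0 < e / 3%:R by rewrite divr_gt0// ltr0n.
have ns1 : `|s| < 1 by rewrite ger0_norm.
have H0 : (fun m => c / (1 - s) * s ^+ m) @ \oo --> c / (1 - s) * 0.
  exact: (cvgM (cvg_cst (c / (1 - s))) (cvg_expC _ ns1)).
rewrite mulr0 in H0; move/cvgr0Pnorm_lt in H0.
have [m me] := @filter_ex _ _ _ _ (H0 _ e3).
have {}me : c * s ^+ m / (1 - s) < e / 3%:R.
  apply: le_lt_trans me; rewrite mulrAC ger0_norm//.
  by rewrite mulr_ge0 ?exprn_ge0 ?divr_ge0// ltW.
have := cvg_series_partial f g m fg; move/cvgrPdist_lt => /(_ _ e3).
apply: filterS => k fk.
have -> : limn (series g) - limn (series (f k)) =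
  (limn (series g) - series g m) + (series g m - series (f k) m)
   - (limn (series (f k)) - series (f k) m) by ring.
have -> : e = e / 3%:R + e / 3%:R + e / 3%:R by field.
rewrite (le_lt_trans (ler_normB _ _))// ltrD//; last first.
  exact: (le_lt_trans (geo_lim_tail _ _ _ m c0 s0 s1 (fs k))).
rewrite (le_lt_trans (ler_normD _ _))// ltrD//.
exact: (le_lt_trans (geo_lim_tail _ _ _ m c0 s0 s1 gs)).
Qed.

Lemma natM_expr_le s t n : 0 <= s -> s <= t ->
  n.+1%:R * (t - s) * s ^+ n <= t ^+ n.+1.
Proof.
move=> s0 st; have ts : 0 <= t - s by rewrite subr_ge0.
have t0 := le_trans s0 st.
(* The graph of the [n.+1]-st power lies above its tangent at [s]; this stronger form is
   inductive. *)
suff : s ^+ n.+1 + n.+1%:R * (t - s) * s ^+ n <= t ^+ n.+1.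
  by apply: le_trans; rewrite lerDr exprn_ge0.
elim: n => [|n IH]; first by rewrite !expr1 expr0 mulr1 mul1r addrC subrK.
rewrite [leRHS]exprS (le_trans _ (ler_wpM2l t0 IH))//.
rewrite -subr_ge0 (_ : _ - _ = n.+1%:R * (t - s) ^+ 2 * s ^+ n); last first.
  by rewrite -[n.+2%:R]natr1 !exprS; ring.
by rewrite mulr_ge0 ?mulr_ge0 ?exprn_ge0.
Qed.

(** A linearly growing weight is absorbed by enlarging the ratio from [s] to [t]. *)
Lemma geo_boundedMn c s t u w : 0 <= c -> 0 <= s -> s < t -> geo_bounded c s u ->
  (forall n, `|w n| <= n.+1%:R) ->
  geo_bounded (c * t / (t - s)) t (fun n => w n * u n).
Proof.
move=> c0 s0 st us wn n; rewrite normrM.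
have ts : 0 < t - s by rewrite subr_gt0.
rewrite (le_trans (ler_pM _ _ (wn n) (us n)))//.
have -> : c * t / (t - s) * t ^+ n = c * (t ^+ n.+1 / (t - s)).
  by rewrite exprS; field; rewrite lt0r_neq0.
rewrite mulrCA ler_wpM2l// ler_pdivlMr// mulrAC.
by rewrite natM_expr_le// ltW.
Qed.
End Tannery.

(** * Infinite products *)

Lemma prod_1D_bounded_real (R : realType) (t r : R) : 0 <= t -> 0 <= r -> r < 1 ->
  forall n, \prod_(j < n) (1 + t * r ^+ j) <= expR (t / (1 - r)).
Proof.
move=> t0 r0 r1 n; have d0 : 0 < 1 - r by rewrite subr_gt0.
(* Each factor obeys [1 + x <= expR x], and the exponents add up to a finite geometric sum. *)
suff H : \prod_(j < n) (1 + t * r ^+ j) <= expR (t * (1 - r ^+ n) / (1 - r)).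
  rewrite (le_trans H)// ler_expR ler_pM2r ?invr_gt0// ler_piMr//.
  by rewrite gerBl exprn_ge0.
elim: n => [|n IH]; first by rewrite big_ord0 subrr mulr0 mul0r expR0.
rewrite big_ord_recr/= (_ : t * _ / _ = t * (1 - r ^+ n) / (1 - r) + t * r ^+ n); last first.
  by rewrite exprS; field; rewrite lt0r_neq0.
rewrite expRD ler_pM ?expR_ge1Dx//.
- by apply: prodr_ge0 => i _; rewrite addr_ge0 ?mulr_ge0 ?exprn_ge0.
- by rewrite addr_ge0 ?mulr_ge0 ?exprn_ge0.
Qed.

Section QPochhammer.
Context {R : realType}.
Local Notation C := (Cplx R).
Implicit Types (a b c e q r s t x y z : C).

Lemma prod_1D_bounded t r : 0 <= t -> 0 <= r -> r < 1 ->
  exists2 c, 0 < c & forall n, \prod_(j < n) (1 + t * r ^+ j) <= c.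
Proof.
move=> t0 r0 r1; have tE := ge0_toC _ t0; have rE := ge0_toC _ r0.
exists (toC (expR (complex.Re t / (1 - complex.Re r)))).
  by rewrite -[0]/(toC 0) lt_toC expR_gt0.
move=> n.
have -> : \prod_(j < n) (1 + t * r ^+ j)
    = toC (\prod_(j < n) (1 + complex.Re t * complex.Re r ^+ j)).
  rewrite (big_morph (@toC R) (@toCM R) (erefl (toC 1))).
  by apply: eq_bigr => j _; rewrite toCD toCM toCX -tE -rE.
rewrite le_toC; apply: prod_1D_bounded_real.
- by rewrite -le_toC -tE; exact: t0.
- by rewrite -le_toC -rE; exact: r0.
- by rewrite -lt_toC -rE; exact: r1.
Qed.

(** The inverse of [1 - s * r ^+ j] is at most [1 + s / (1 - s) * r ^+ j], so the upper bound for
    products of the latter kind bounds the inverse product. *)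
Lemma prod_1B_bounded_away s r : 0 <= s -> s < 1 -> 0 <= r -> r < 1 ->
  exists2 c, 0 < c & forall n, c <= \prod_(j < n) (1 - s * r ^+ j).
Proof.
move=> s0 s1 r0 r1; have d0 : 0 < 1 - s by rewrite subr_gt0.
have [c c0 H] := prod_1D_bounded (s / (1 - s)) r (divr_ge0 s0 (ltW d0)) r0 r1.
exists c^-1; first by rewrite invr_gt0.
have sr j : s * r ^+ j <= s by rewrite ler_piMr// exprn_ile1// ltW.
have p0 j : 0 < 1 - s * r ^+ j by rewrite subr_gt0 (le_lt_trans (sr j)).
move=> n; have P0 : 0 < \prod_(j < n) (1 - s * r ^+ j) by apply: prodr_gt0.
rewrite -[leRHS]invrK lef_pV2 ?posrE ?invr_gt0//; apply: le_trans (H n).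
rewrite -prodfV; apply: ler_prod => j _; rewrite invr_ge0 (ltW (p0 j))/=.
rewrite -div1r ler_pdivrMr//.
have -> : (1 + s / (1 - s) * r ^+ j) * (1 - s * r ^+ j)
   = 1 + s * r ^+ j * (s - s * r ^+ j) / (1 - s) by field; rewrite lt0r_neq0.
by rewrite lerDl divr_ge0 ?(ltW d0)// mulr_ge0 ?subr_ge0// mulr_ge0 ?exprn_ge0.
Qed.

Lemma qpochS a q n : qpoch a q n.+1 = qpoch a q n * (1 - a * q ^+ n).
Proof. by rewrite /qpoch big_ord_recr. Qed.

Lemma qpoch0 a q : qpoch a q 0 = 1.
Proof. by rewrite /qpoch big_ord0. Qed.

Lemma qpochSl a q n : qpoch a q n.+1 = (1 - a) * qpoch (a * q) q n.
Proof.
rewrite /qpoch big_ord_recl expr0 mulr1; congr (_ * _).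
by apply: eq_bigr => j _; rewrite /bump/= exprS mulrA.
Qed.

(** The bound is uniform in [a] as well as in [n]: the denominators of the series need one bound for
    a whole disc of parameters. *)
Lemma qpoch_bounded_away q s : `|q| < 1 -> 0 <= s -> s < 1 ->
  exists2 c, 0 < c & forall a n, `|a| <= s -> c <= `|qpoch a q n|.
Proof.
move=> q1 s0 s1; have [c c0 H] := prod_1B_bounded_away s `|q| s0 s1 (normr_ge0 _) q1.
exists c => // a n as_; rewrite (le_trans (H n))// /qpoch normr_prod.
apply: ler_prod => j _; apply/andP; split.
  by rewrite subr_ge0 (le_trans _ (ltW s1))// ler_piMr// exprn_ile1// ltW.
rewrite (le_trans _ (lerB_dist _ _))// normr1 lerB//.
by rewrite normrM normrX ler_wpM2r ?exprn_ge0.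
Qed.

(** The partial products are bounded, so their increments [- qpoch a q n * a * q ^+ n] decay
    geometrically and the telescoping series converges. *)
Lemma cvg_qpoch a q : `|q| < 1 -> qpoch a q @ \oo --> qpoch_inf a q.
Proof.
move=> q1; have [c c0 H] := prod_1D_bounded `|a| `|q| (normr_ge0 _) (normr_ge0 _) q1.
have B n : `|qpoch a q n| <= c.
  rewrite (le_trans _ (H n))// /qpoch normr_prod; apply: ler_prod => j _.
  by rewrite normr_ge0/= (le_trans (ler_normB _ _))// normr1 normrM normrX.
have G : geo_bounded (c * `|a|) `|q| (telescope (qpoch a q)).
  move=> n; rewrite /telescope/= qpochS.
  have -> : qpoch a q n * (1 - a * q ^+ n) - qpoch a q n
     = - (qpoch a q n * a * q ^+ n) by ring.
  rewrite normrN normrM normrX ler_wpM2r ?exprn_ge0// normrM.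
  by rewrite ler_wpM2r.
have cv := cvg_series_geo _ _ _ (mulr_ge0 (ltW c0) (normr_ge0 a)) (normr_ge0 q) q1 G.
have E : qpoch a q = (fun n => 1 + series (telescope (qpoch a q)) n).
  by apply/funext => n; rewrite -(qpoch0 a q) -eq_sum_telescope.
have K : (fun n => 1 + series (telescope (qpoch a q)) n) @ \oo
    --> 1 + limn (series (telescope (qpoch a q))).
  exact: (cvgD (cvg_cst (1 : C)) cv).
rewrite -E in K; rewrite /qpoch_inf; apply/cvg_ex.
by eexists; exact: K.
Qed.

Lemma qpoch_inf_neq0 a q : `|q| < 1 -> `|a| < 1 -> qpoch_inf a q != 0.
Proof.
move=> q1 a1; apply/eqP => E.
have [c c0 H] := qpoch_bounded_away q `|a| q1 (normr_ge0 _) a1.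
have := cvg_qpoch a q q1; rewrite E => /cvgr0Pnorm_lt/(_ _ c0) K.
have [n nc] := @filter_ex _ _ _ _ K.
by have := le_lt_trans (H a n (lexx _)) nc; rewrite ltxx.
Qed.

Lemma qpoch_neq0 a q n : `|q| < 1 -> `|a| < 1 -> qpoch a q n != 0.
Proof.
move=> q1 a1; have [c c0 H] := qpoch_bounded_away q `|a| q1 (normr_ge0 _) a1.
by rewrite -normr_gt0 (lt_le_trans c0)// H.
Qed.

Lemma qpoch_infSl a q : `|q| < 1 -> qpoch_inf a q = (1 - a) * qpoch_inf (a * q) q.
Proof.
move=> q1.
have A : (fun n => qpoch a q n.+1) @ \oo --> qpoch_inf a q.
  by rewrite (cvg_shiftS (qpoch a q)); exact: cvg_qpoch.
have B : (fun n => qpoch a q n.+1) @ \oo --> (1 - a) * qpoch_inf (a * q) q.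
  under eq_fun do rewrite qpochSl.
  exact: (cvgM (cvg_cst (1 - a)) (cvg_qpoch (a * q) q q1)).
exact: (norm_cvg_unique A B).
Qed.
End QPochhammer.

(** * The partial fraction series *)

Section PartialFractions.
Context {R : realType}.
Local Notation C := (Cplx R).
Implicit Types (u v w : nat -> C) (a b c l m s t x y z : C).

Lemma cvg_seriesSl u l : series u @ \oo --> l ->
  series (fun n => u n.+1) @ \oo --> l - u 0.
Proof.
move=> ul.
have -> : series (fun n => u n.+1) = (fun n => series u n.+1 - u 0).
  apply/funext => n; rewrite /series/= big_nat_recl//=.
  by rewrite addrC addKr.
have sl : (fun n => series u n.+1) @ \oo --> l by rewrite (cvg_shiftS (series u)).
exact: (cvgB sl (cvg_cst (u 0))).
Qed.

Lemma cvg_seriesD u v l m : series u @ \oo --> l -> series v @ \oo --> m ->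
  series (fun n => u n + v n) @ \oo --> l + m.
Proof.
move=> ul vm.
have -> : series (fun n => u n + v n) = (fun n => series u n + series v n).
  by apply/funext => n; rewrite /series/= big_split.
exact: (cvgD ul vm).
Qed.

Lemma cvg_seriesM c u l : series u @ \oo --> l ->
  series (fun n => c * u n) @ \oo --> c * l.
Proof.
move=> ul.
have -> : series (fun n => c * u n) = (fun n => c * series u n).
  by apply/funext => n; rewrite /series/= mulr_sumr.
exact: (cvgM (cvg_cst c) ul).
Qed.

Lemma cvg_series_unique u l m : series u @ \oo --> l -> series u @ \oo --> m -> l = m.
Proof. by move=> ul um; exact: (norm_cvg_unique ul um). Qed.

Variable q : C.
Hypothesis q1 : `|q| < 1.

(* For [a != 0] this is [(q / a; q)_n a ^ n / (b; q)_(n + 1)], rewritten so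
   as to make sense at [a = 0]. *)
Definition reci a b n := (\prod_(j < n) (a - q ^+ j.+1)) / qpoch b q n.+1.

Lemma reci0 a b : reci a b 0 = (1 - b)^-1.
Proof. by rewrite /reci big_ord0 qpochS qpoch0 expr0 mulr1 !mul1r. Qed.

(** Pulling [s] out of each numerator factor leaves the bounded product of the
    [1 + |q| / s * |q| ^+ j], and the denominators stay away from 0, uniformly on the disc of radius
    [s]. *)
Lemma reci_geo s : 0 < s -> s < 1 -> exists2 c, 0 <= c &
  forall a b, `|a| <= s -> `|b| <= s -> geo_bounded c s (reci a b).
Proof.
move=> s0 s1.
have [c c0 Hc] := prod_1D_bounded (`|q| / s) `|q|
  (divr_ge0 (normr_ge0 _) (ltW s0)) (normr_ge0 _) q1.
have [d d0 Hd] := qpoch_bounded_away q s q1 (ltW s0) s1.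
exists (c / d); first by rewrite divr_ge0 ?ltW.
move=> a b a_s b_s n; rewrite /reci normrM normfV mulrAC.
apply: ler_pM; rewrite ?invr_ge0//; last first.
  rewrite lef_pV2 ?posrE//; first exact: Hd.
  exact: lt_le_trans d0 (Hd b _ b_s).
rewrite normr_prod.
apply: (@le_trans _ _ (\prod_(j < n) (s * (1 + `|q| / s * `|q| ^+ j)))).
  apply: ler_prod => j _; rewrite normr_ge0/= (le_trans (ler_normB _ _))//.
  rewrite mulrDr mulr1 lerD// mulrA mulrCA divff ?lt0r_neq0// mulr1 -exprS normrX.
  exact: lexx.
rewrite big_split/= prodr_const card_ord mulrC.
by apply: ler_wpM2r; [rewrite exprn_ge0// ltW|exact: Hc].
Qed.

Lemma mul_reci_geo w s : 0 < s -> s < 1 -> (forall n, `|w n| <= n.+1%:R) ->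
  exists c t, [/\ 0 <= c, 0 <= t, t < 1 & forall a b, `|a| <= s -> `|b| <= s ->
    geo_bounded c t (fun n => w n * reci a b n)].
Proof.
move=> s0 s1 wn; have [c c0 Hc] := reci_geo s s0 s1.
(* The midpoint of [s] and 1 is the larger ratio that absorbs the weight [w]. *)
have st : s < (s + 1) / 2%:R by rewrite midf_lt.
have t1 : (s + 1) / 2%:R < 1 by rewrite midf_lt.
have t0 := ltW (lt_trans s0 st).
exists (c * ((s + 1) / 2%:R) / ((s + 1) / 2%:R - s)), ((s + 1) / 2%:R); split => //.
  by apply: divr_ge0; [exact: mulr_ge0|rewrite subr_ge0 ltW].
by move=> a b a_s b_s; exact: (geo_boundedMn _ _ _ _ _ c0 (ltW s0) st (Hc _ _ a_s b_s) wn).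
Qed.

Lemma common_radius x y : `|x| < 1 -> `|y| < 1 ->
  exists s, [/\ 0 < s, s < 1, `|x| <= s & `|y| <= s].
Proof.
(* A closed form that avoids a maximum in a partial order; the halving keeps it positive even when
   both [x] and [y] vanish. *)
move=> x1 y1; exists (1 - (1 - `|x|) * (1 - `|y|) / 2%:R).
have p : 0 < 1 - `|x| by rewrite subr_gt0.
have p' : 0 < 1 - `|y| by rewrite subr_gt0.
have h : 0 < (2%:R^-1 : C) by rewrite invr_gt0 ltr0n.
have h1 : (2%:R^-1 : C) < 1 by rewrite invf_lt1 ?ltr1n ?ltr0n.
have le1 (z : C) : 1 - `|z| <= 1 by rewrite gerBl.
have E (z : C) (r : C) : 0 < 1 - `|z| -> r <= 1 -> `|z| <= 1 - (1 - `|z|) * r.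
  move=> z1 r1; rewrite -subr_ge0 (_ : _ - _ = (1 - `|z|) * (1 - r)); last by ring.
  by apply: mulr_ge0; [exact: ltW|rewrite subr_ge0].
split.
- rewrite subr_gt0; apply: le_lt_trans h1.
  by rewrite ger_pMl// mulr_ile1 ?(ltW p) ?(ltW p') ?le1.
- by rewrite gtrBl !mulr_gt0.
- by rewrite -mulrA E// mulr_ile1 ?(ltW h) ?(ltW h1) ?(ltW p') ?le1.
- by rewrite [X in X / _]mulrC -mulrA E// mulr_ile1 ?(ltW h) ?(ltW h1) ?(ltW p) ?le1.
Qed.

(** A general weight treats convergence and continuity for the weights 1 and [n] at once. *)
Definition rsum w a b := limn (series (fun n => w n * reci a b n)).

Lemma cvg_rsum w a b : `|a| < 1 -> `|b| < 1 -> (forall n, `|w n| <= n.+1%:R) ->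
  series (fun n => w n * reci a b n) @ \oo --> rsum w a b.
Proof.
move=> a1 b1 wn; have [s [s0 s1 a_s b_s]] := common_radius a b a1 b1.
have [c [t [c0 t0 t1 H]]] := mul_reci_geo w s s0 s1 wn.
exact: (cvg_series_geo c t _ c0 t0 t1 (H a b a_s b_s)).
Qed.

Lemma cvg_reci (x y : nat -> C) a b n : `|b| < 1 ->
  x @ \oo --> a -> y @ \oo --> b ->
  (fun k => reci (x k) (y k) n) @ \oo --> reci a b n.
Proof.
move=> b1 xa yb.
have X : (fun k => \prod_(j < n) (x k - q ^+ j.+1)) @ \oo -->
    \prod_(j < n) (a - q ^+ j.+1).
  elim: n => [|n IH].
    by under eq_fun do rewrite big_ord0; rewrite big_ord0; exact: cvg_cst.
  under eq_fun do rewrite big_ord_recr/=; rewrite big_ord_recr/=.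
  exact: (cvgM IH (cvgB xa (cvg_cst (q ^+ n.+1)))).
have Y (m : nat) : (fun k => qpoch (y k) q m) @ \oo --> qpoch b q m.
  elim: m => [|m IH].
    by under eq_fun do rewrite qpoch0; rewrite qpoch0; exact: cvg_cst.
  under eq_fun do rewrite qpochS; rewrite qpochS.
  exact: (cvgM IH (cvgB (cvg_cst (1 : C)) (cvgM yb (cvg_cst (q ^+ m))))).
exact: (cvgM X (cvgV (qpoch_neq0 b q n.+1 q1 b1) (Y n.+1))).
Qed.

Lemma cvg_rsum_param w (x y : nat -> C) s a b :
  0 < s -> s < 1 -> (forall n, `|w n| <= n.+1%:R) ->
  (forall k, `|x k| <= s) -> (forall k, `|y k| <= s) -> `|a| <= s -> `|b| <= s ->
  x @ \oo --> a -> y @ \oo --> b ->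
  (fun k => rsum w (x k) (y k)) @ \oo --> rsum w a b.
Proof.
move=> s0 s1 wn xs ys a_s b_s xa yb.
have [c [t [c0 t0 t1 H]]] := mul_reci_geo w s s0 s1 wn.
have fg n : (fun k => w n * reci (x k) (y k) n) @ \oo --> w n * reci a b n.
  exact: (cvgM (cvg_cst (w n)) (cvg_reci x y a b n (le_lt_trans b_s s1) xa yb)).
exact: (tannery c t (fun k n => w n * reci (x k) (y k) n)
  (fun n => w n * reci a b n) c0 t0 t1
  (fun k => H _ _ (xs k) (ys k)) (H _ _ a_s b_s) fg).
Qed.
End PartialFractions.

(** * Contiguous relations under the shift from [a] to [a q] *)

Section Contiguity.
Context {R : realType}.
Local Notation C := (Cplx R).
Implicit Types (a b x y : C).
Variable q : C.
Hypothesis q1 : `|q| < 1.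

Lemma norm_mulq_lt1 a : `|a| < 1 -> `|a * q| < 1.
Proof. by move=> a1; rewrite normrM mulr_ilt1. Qed.

Lemma norm_mul_lt1 a b : `|a| < 1 -> `|b| < 1 -> `|a * b| < 1.
Proof. by move=> a1 b1; rewrite normrM mulr_ilt1. Qed.

Lemma one_sub_neq0 a : `|a| < 1 -> 1 - a != 0.
Proof. by move=> a1; rewrite subr_eq0; apply: contraTneq a1 => <-; rewrite normr1 ltxx. Qed.

Lemma reciS a b n : `|b| < 1 ->
  reci q a b n.+1 = reci q a b n * (a - q ^+ n.+1) / (1 - b * q ^+ n.+1).
Proof.
move=> b1; have := qpoch_neq0 b q n.+2 q1 b1; rewrite qpochS mulf_eq0 => /norP[A B].
rewrite /reci big_ord_recr/= (qpochS _ _ n.+1); field.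
by rewrite A B.
Qed.

Lemma one_sub_expr_neq0 b n : `|b| < 1 -> 1 - b * q ^+ n != 0.
Proof. by move=> b1; have := qpoch_neq0 b q n.+1 q1 b1; rewrite qpochS mulf_eq0 => /norP[]. Qed.

(** Since [a * q - q ^+ j.+1 = q * (a - q ^+ j)], the shift moves the product back by one index; its
    new first factor is [a - 1]. *)
Lemma reci_mulq_num a b n : `|b| < 1 ->
  reci q (a * q) b n.+1 = (a - 1) * q ^+ n.+1 * reci q a b n / (1 - b * q ^+ n.+1).
Proof.
move=> b1; have := qpoch_neq0 b q n.+2 q1 b1; rewrite qpochS mulf_eq0 => /norP[A B].
rewrite /reci (qpochS _ _ n.+1).
have -> : \prod_(j < n.+1) (a * q - q ^+ j.+1)
    = (a - 1) * q ^+ n.+1 * \prod_(j < n) (a - q ^+ j.+1).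
  rewrite (eq_bigr (fun j : 'I_n.+1 => q * (a - q ^+ j))); last first.
    by move=> j _; rewrite exprS; ring.
  rewrite big_split/= prodr_const card_ord big_ord_recl/= expr0.
  by rewrite mulrCA mulrA.
by field; rewrite A B.
Qed.

(** Splitting [qpoch a q n.+2] at its first or at its last factor compares the two denominators. *)
Lemma reci_mulq_den a b n : `|a| < 1 ->
  reci q b (a * q) n = (1 - a) * reci q b a n / (1 - a * q ^+ n.+1).
Proof.
move=> a1; have := qpochS a q n.+1; rewrite qpochSl => E.
have N1 := qpoch_neq0 a q n.+1 q1 a1.
have N2 := one_sub_expr_neq0 a n.+1 a1.
have N3 := qpoch_neq0 (a * q) q n.+1 q1 (norm_mulq_lt1 a a1).
rewrite /reci; apply: (mulIf N1); apply: (mulIf N2); apply: (mulIf N3).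
rewrite -mulrA -[RHS]mulrA.
set X := qpoch (a * q) q n.+1 in E N3 *; set Y := qpoch a q n.+1 in E N1 *.
set P := \prod_(j < n) _.
have -> : P / X * Y * ((1 - a * q ^+ n.+1) * X) = P * (Y * (1 - a * q ^+ n.+1)) by field.
by rewrite -E; field; rewrite N1 N2.
Qed.

(** Over the common denominator this is [a - q ^+ n.+1 - a * (1 - b * q ^+ n.+1) = - q ^+ n.+1 * (1
    - a * b)]. *)
Lemma reci_num_telescope a b n : `|b| < 1 ->
  (1 - a * b) * reci q (a * q) b n.+1
  = (1 - a) * (reci q a b n.+1 - a * reci q a b n).
Proof.
move=> b1; rewrite reci_mulq_num// reciS//.
by field; exact: one_sub_expr_neq0.
Qed.

(** Over the common denominator this is [1 - a * q ^+ n.+1 - a * (b - q ^+ n.+1) = 1 - a * b]. *)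
Lemma reci_den_telescope a b n : `|a| < 1 ->
  (1 - a * b) * reci q b (a * q) n
  = (1 - a) * (reci q b a n - a * reci q b a n.+1).
Proof.
move=> a1; rewrite reci_mulq_den// reciS//.
by field; exact: one_sub_expr_neq0.
Qed.

Definition rsum0 := rsum q (fun=> 1).
Definition rsum1 := rsum q (fun n => n%:R).

Lemma cvg_rsum0 a b : `|a| < 1 -> `|b| < 1 ->
  series (reci q a b) @ \oo --> rsum0 a b.
Proof.
move=> a1 b1; have -> : reci q a b = (fun n => 1 * reci q a b n).
  by apply/funext => n; rewrite mul1r.
by apply: cvg_rsum => // n; rewrite normr1 ler1n.
Qed.

Lemma cvg_rsum1 a b : `|a| < 1 -> `|b| < 1 ->
  series (fun n => n%:R * reci q a b n) @ \oo --> rsum1 a b.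
Proof. by move=> a1 b1; apply: cvg_rsum => // n; rewrite normr_nat ler_nat. Qed.

Lemma cvg_rsum1S a b : `|a| < 1 -> `|b| < 1 ->
  series (fun n => n.+1%:R * reci q a b n) @ \oo --> rsum1 a b + rsum0 a b.
Proof.
move=> a1 b1.
have -> : (fun n => n.+1%:R * reci q a b n) = (fun n => n%:R * reci q a b n + reci q a b n).
  by apply/funext => n; rewrite -natr1 mulrDl mul1r.
exact: (cvg_seriesD _ _ _ _ (cvg_rsum1 a b a1 b1) (cvg_rsum0 a b a1 b1)).
Qed.

Lemma cvg_rsum1_shift a b : `|a| < 1 -> `|b| < 1 ->
  series (fun n => n.+1%:R * reci q a b n.+1) @ \oo --> rsum1 a b.
Proof.
move=> a1 b1; have := cvg_seriesSl _ _ (cvg_rsum1 a b a1 b1).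
by rewrite mul0r subr0; exact.
Qed.

(** The termwise relation starts at index 1; the omitted terms [(1 - b)^-1] on both sides combine to
    the inhomogeneous term [a]. *)
Lemma rsum0_mulq_num a b : `|a| < 1 -> `|b| < 1 ->
  (1 - a * b) * rsum0 (a * q) b = a + (1 - a) ^+ 2 * rsum0 a b.
Proof.
move=> a1 b1; have aq1 := norm_mulq_lt1 a a1.
have L := cvg_seriesM (1 - a * b) _ _ (cvg_seriesSl _ _ (cvg_rsum0 _ b aq1 b1)).
have S := cvg_rsum0 a b a1 b1.
have U := cvg_seriesM (1 - a) _ _ (cvg_seriesD _ _ _ _ (cvg_seriesSl _ _ S)
  (cvg_seriesM (- a) _ _ S)).
have E : (fun n => (1 - a * b) * reci q (a * q) b n.+1)
    = (fun n => (1 - a) * (reci q a b n.+1 + - a * reci q a b n)).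
  by apply/funext => n; rewrite reci_num_telescope// mulNr.
rewrite E in L; have := cvg_series_unique _ _ _ L U; rewrite !reci0 => K.
have D := one_sub_neq0 b b1.
have -> : (1 - a * b) * rsum0 (a * q) b
    = (1 - a * b) * (rsum0 (a * q) b - (1 - b)^-1) + (1 - a * b) / (1 - b) by ring.
by rewrite K; field.
Qed.

(** The omitted first term [(1 - a)^-1] of the shifted series yields the same inhomogeneous term
    [a], which will cancel in the antisymmetric difference. *)
Lemma rsum0_mulq_den a b : `|a| < 1 -> `|b| < 1 ->
  (1 - a * b) * rsum0 b (a * q) = a + (1 - a) ^+ 2 * rsum0 b a.
Proof.
move=> a1 b1; have aq1 := norm_mulq_lt1 a a1.
have L := cvg_seriesM (1 - a * b) _ _ (cvg_rsum0 b _ b1 aq1).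
have S := cvg_rsum0 b a b1 a1.
have U := cvg_seriesM (1 - a) _ _ (cvg_seriesD _ _ _ _ S
  (cvg_seriesM (- a) _ _ (cvg_seriesSl _ _ S))).
have E : (fun n => (1 - a * b) * reci q b (a * q) n)
    = (fun n => (1 - a) * (reci q b a n + - a * reci q b a n.+1)).
  by apply/funext => n; rewrite reci_den_telescope// mulNr.
rewrite E in L; rewrite (cvg_series_unique _ _ _ L U) reci0.
by field; exact: one_sub_neq0.
Qed.

(** The weight vanishes at index 0, so no boundary term remains; rewriting the weight [n.+1] of the
    unshifted series as [n + 1] brings in [rsum0]. *)
Lemma rsum1_mulq_num a b : `|a| < 1 -> `|b| < 1 ->
  (1 - a * b) * rsum1 (a * q) b = (1 - a) * ((1 - a) * rsum1 a b - a * rsum0 a b).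
Proof.
move=> a1 b1; have aq1 := norm_mulq_lt1 a a1.
have L := cvg_seriesM (1 - a * b) _ _ (cvg_rsum1_shift _ b aq1 b1).
have U := cvg_seriesM (1 - a) _ _ (cvg_seriesD _ _ _ _ (cvg_rsum1_shift a b a1 b1)
  (cvg_seriesM (- a) _ _ (cvg_rsum1S a b a1 b1))).
have E : (fun n => (1 - a * b) * (n.+1%:R * reci q (a * q) b n.+1))
    = (fun n => (1 - a) * (n.+1%:R * reci q a b n.+1 + - a * (n.+1%:R * reci q a b n))).
  by apply/funext => n; rewrite mulrCA reci_num_telescope//; ring.
rewrite E in L; rewrite (cvg_series_unique _ _ _ L U).
by ring.
Qed.

(** Here the weight [n] on the term of index [n.+1] is written [n.+1 - 1]; the [- 1] contributes
    [rsum0] without its first term, hence the final [- a]. *)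
Lemma rsum1_mulq_den a b : `|a| < 1 -> `|b| < 1 ->
  (1 - a * b) * rsum1 b (a * q)
  = (1 - a) ^+ 2 * rsum1 b a + (1 - a) * a * rsum0 b a - a.
Proof.
move=> a1 b1; have aq1 := norm_mulq_lt1 a a1.
have L := cvg_seriesM (1 - a * b) _ _ (cvg_rsum1 b _ b1 aq1).
have S := cvg_rsum0 b a b1 a1.
have U := cvg_seriesM (1 - a) _ _ (cvg_seriesD _ _ _ _ (cvg_rsum1 b a b1 a1)
  (cvg_seriesM (- a) _ _ (cvg_seriesD _ _ _ _ (cvg_rsum1_shift b a b1 a1)
  (cvg_seriesM (-1) _ _ (cvg_seriesSl _ _ S))))).
have E : (fun n => (1 - a * b) * (n%:R * reci q b (a * q) n))
    = (fun n => (1 - a) * (n%:R * reci q b a n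
       + - a * (n.+1%:R * reci q b a n.+1 + -1 * reci q b a n.+1))).
  by apply/funext => n; rewrite mulrCA reci_den_telescope// -natr1; ring.
rewrite E in L; rewrite (cvg_series_unique _ _ _ L U) reci0.
by field; exact: one_sub_neq0.
Qed.
End Contiguity.

(** * Solving the q-difference equation and fixing its constant *)

Section Evaluation.
Context {R : realType}.
Local Notation C := (Cplx R).
Implicit Types (a b : C) (F : C -> C -> C).
Variable q : C.
Hypothesis q1 : `|q| < 1.

Lemma norm_mulqX_le a n : `|a * q ^+ n| <= `|a|.
Proof. by rewrite normrM normrX ler_piMr// exprn_ile1// ltW. Qed.

Lemma cvg_mulqX a : (fun n => a * q ^+ n) @ \oo --> (0 : C).
Proof. by rewrite -(mulr0 a); exact: (cvgM (cvg_cst a) (cvg_expC q q1)). Qed.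

Lemma cvg_rsum_num w a b : `|a| < 1 -> `|b| < 1 -> (forall n, `|w n| <= n.+1%:R) ->
  (fun n => rsum q w (a * q ^+ n) b) @ \oo --> rsum q w 0 b.
Proof.
move=> a1 b1 wn; have [s [s0 s1 a_s b_s]] := common_radius a b a1 b1.
apply: (cvg_rsum_param q q1 w _ (fun=> b) s 0 b s0 s1 wn _ (fun=> b_s) _
  b_s (cvg_mulqX a) (cvg_cst b)).
- by move=> k; exact: (le_trans (norm_mulqX_le a k) a_s).
- by rewrite normr0 ltW.
Qed.

Lemma cvg_rsum_den w a b : `|a| < 1 -> `|b| < 1 -> (forall n, `|w n| <= n.+1%:R) ->
  (fun n => rsum q w b (a * q ^+ n)) @ \oo --> rsum q w b 0.
Proof.
move=> a1 b1 wn; have [s [s0 s1 a_s b_s]] := common_radius a b a1 b1.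
apply: (cvg_rsum_param q q1 w (fun=> b) _ s b 0 s0 s1 wn (fun=> b_s) _
  b_s _ (cvg_cst b) (cvg_mulqX a)).
- by move=> k; exact: (le_trans (norm_mulqX_le a k) a_s).
- by rewrite normr0 ltW.
Qed.

Lemma norm_cst1_le n : `|1 : C| <= n.+1%:R.
Proof. by rewrite normr1 ler1n. Qed.

Lemma norm_nat_le n : `|n%:R : C| <= n.+1%:R.
Proof. by rewrite normr_nat ler_nat. Qed.

Definition qdiff F := forall a b, `|a| < 1 -> `|b| < 1 ->
  (1 - a * b) * F (a * q) b = (1 - a) ^+ 2 * F a b.

(** Continuity at 0 is asked only along the orbit [a * q ^+ n], where the iteration takes place. *)
Definition qcont F := forall a b, `|a| < 1 -> `|b| < 1 ->
  (fun n => F (a * q ^+ n) b) @ \oo --> F 0 b.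

Lemma qdiff_iter F a b n : qdiff F -> `|a| < 1 -> `|b| < 1 ->
  F a b * qpoch a q n ^+ 2 = qpoch (a * b) q n * F (a * q ^+ n) b.
Proof.
move=> Fq a1 b1; elim: n => [|n IH].
  by rewrite !qpoch0 expr1n expr0 !mulr1 mul1r.
have an1 := le_lt_trans (norm_mulqX_le a n) a1.
have K := Fq _ _ an1 b1.
rewrite !qpochS exprMn mulrA IH (exprSr q) (mulrA a).
by rewrite -mulrA (mulrC (F _ b)) -K; ring.
Qed.

Lemma qdiff_lim F a b : qdiff F -> qcont F -> `|a| < 1 -> `|b| < 1 ->
  F a b * qpoch_inf a q ^+ 2 = qpoch_inf (a * b) q * F 0 b.
Proof.
move=> Fq Fc a1 b1.
have P := cvg_qpoch a q q1.
have L : (fun n => F a b * qpoch a q n ^+ 2) @ \oo --> F a b * qpoch_inf a q ^+ 2.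
  exact: (cvgM (cvg_cst (F a b)) (cvgM P P)).
have E : (fun n => F a b * qpoch a q n ^+ 2)
    = (fun n => qpoch (a * b) q n * F (a * q ^+ n) b).
  by apply/funext => n; exact: qdiff_iter.
rewrite E in L.
exact: (norm_cvg_unique L (cvgM (cvg_qpoch (a * b) q q1) (Fc a b a1 b1))).
Qed.

Lemma qpoch_inf0 : qpoch_inf 0 q = 1.
Proof.
have P := cvg_qpoch 0 q q1.
have E : qpoch 0 q = (fun=> 1).
  by apply/funext => n; rewrite /qpoch big1// => j _; rewrite mul0r subr0.
by rewrite E in P; exact: (norm_cvg_unique P (cvg_cst (1 : C))).
Qed.

(** Sending the first variable to 0 leaves [F 0 b], which is [e * F b 0]; its first variable is then
    sent to 0 in turn. The sign [e] is -1 for [asum] and 1 for [ssum]. *)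
Lemma qdiff_eval F e a b : qdiff F -> qcont F ->
  (forall x y, `|x| < 1 -> `|y| < 1 -> F x y = e * F y x) -> `|a| < 1 -> `|b| < 1 ->
  F a b * (qpoch_inf a q ^+ 2 * qpoch_inf b q ^+ 2) = qpoch_inf (a * b) q * (e * F 0 0).
Proof.
move=> Fq Fc Fs a1 b1.
have z1 : `|0 : C| < 1 by rewrite normr0 ltr01.
rewrite mulrA (qdiff_lim F)// Fs//.
have := qdiff_lim F b 0 Fq Fc b1 z1; rewrite mulr0 qpoch_inf0 mul1r => <-.
by ring.
Qed.

Definition asum a b := rsum0 q a b - rsum0 q b a.

(** The sum [S], with the weight [n + 1] of its second series split into [n] and 1. *)
Definition ssum a b := rsum1 q a b + (rsum1 q b a + rsum0 q b a).

Lemma rsum0C a b : `|a| < 1 -> `|b| < 1 -> rsum0 q a b = rsum0 q b a.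
Proof.
move=> a1 b1; apply/eqP; rewrite -subr_eq0; apply/eqP.
have Tq : qdiff asum.
  move=> x y x1 y1; rewrite /asum mulrBr rsum0_mulq_num// rsum0_mulq_den//.
  by ring.
have Tc : qcont asum.
  move=> x y x1 y1; exact: (cvgB (cvg_rsum_num _ _ _ x1 y1 norm_cst1_le)
    (cvg_rsum_den _ _ _ x1 y1 norm_cst1_le)).
have Ts x y : `|x| < 1 -> `|y| < 1 -> asum x y = -1 * asum y x.
  by move=> _ _; rewrite /asum; ring.
have := qdiff_eval asum (-1) a b Tq Tc Ts a1 b1.
(* [asum 0 0] is a difference of equal terms, so [asum a b] times nonvanishing infinite products is
   0. *)
rewrite [asum 0 0]subrr !mulr0 => /eqP; rewrite mulf_eq0 => /orP[/eqP//|].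
by rewrite mulf_eq0 !expf_eq0/= !(negbTE (qpoch_inf_neq0 _ _ _ _)).
Qed.

Lemma ssumE a b : `|a| < 1 -> `|b| < 1 ->
  ssum a b * (qpoch_inf a q ^+ 2 * qpoch_inf b q ^+ 2) = qpoch_inf (a * b) q * ssum 0 0.
Proof.
move=> a1 b1; rewrite -(mul1r (ssum 0 0)).
apply: qdiff_eval => //.
- move=> x y x1 y1; rewrite /ssum !mulrDr rsum1_mulq_num// rsum1_mulq_den//.
  (* The constants [x] and [- x] cancel, and symmetry of [rsum0] cancels the two terms
     [(1 - x) * x * rsum0]. *)
  by rewrite rsum0_mulq_den// (rsum0C x y)//; ring.
- move=> x y x1 y1.
  exact: (cvgD (cvg_rsum_num _ _ _ x1 y1 norm_nat_le)
    (cvgD (cvg_rsum_den _ _ _ x1 y1 norm_nat_le)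
          (cvg_rsum_den _ _ _ x1 y1 norm_cst1_le))).
- by move=> x y x1 y1; rewrite /ssum (rsum0C x y)//; ring.
Qed.

Lemma reci_qq n : reci q q q n.+1 = 0.
Proof. by rewrite /reci big_ord_recl/= expr1 subrr !mul0r. Qed.

Lemma ssum_qq : ssum q q = (1 - q)^-1.
Proof.
have S0 : rsum0 q q q = (1 - q)^-1.
  have S := cvg_seriesSl _ _ (cvg_rsum0 q q1 q q q1 q1).
  (* The vanishing tail is written as 0 times a convergent series, so that uniqueness of limits
     gives its sum. *)
  have Z : (fun n => reci q q q n.+1) = (fun n => 0 * reci q q q n).
    by apply/funext => n; rewrite reci_qq mul0r.
  rewrite Z in S.
  have := cvg_series_unique _ _ _ S (cvg_seriesM 0 _ _ (cvg_rsum0 q q1 q q q1 q1)).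
  by rewrite mul0r reci0 => /eqP; rewrite subr_eq0 => /eqP.
have S1 : rsum1 q q q = 0.
  have S := cvg_rsum1 q q1 q q q1 q1.
  have Z : (fun n => n%:R * reci q q q n) = (fun n => 0 * reci q q q n).
    by apply/funext => -[|n]; rewrite ?mul0r// reci_qq mulr0.
  rewrite Z in S.
  have := cvg_series_unique _ _ _ S (cvg_seriesM 0 _ _ (cvg_rsum0 q q1 q q q1 q1)).
  by rewrite mul0r.
by rewrite /ssum S0 S1 !add0r.
Qed.

Hypothesis q0 : q != 0.

Lemma ssum00 : ssum 0 0 = qpoch_inf q q ^+ 3.
Proof.
have qq1 := norm_mul_lt1 q q q1 q1.
have N := qpoch_inf_neq0 (q * q) q q1 qq1.
have D := one_sub_neq0 q q1.
(* At [a = b = q] the evaluation reads [(q * q; q)_oo S(0, 0) = (q; q)_oo ^ 4 / (1 - q)], and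
   [(q; q)_oo = (1 - q) (q * q; q)_oo]. *)
apply: (mulfI N); rewrite -ssumE// ssum_qq (qpoch_infSl q q q1).
by field.
Qed.
End Evaluation.

(** * Return to the series in its original form *)

Theorem theorem2p13 (R : realType) (q a b : Cplx R)
    (q_gt0 : 0 < `|q|) (q_lt1 : `|q| < 1)
    (a_neq0 : a != 0) (b_neq0 : b != 0)
    (a_lt1 : `|a| < 1) (b_lt1 : `|b| < 1) :
  series (fun n : nat =>
      n%:R * qpoch (q / a) q n * a ^+ n / qpoch b q n.+1
      + n.+1%:R * qpoch (q / b) q n * b ^+ n / qpoch a q n.+1) @ \oo -->
    qpoch_inf q q ^+ 3 * qpoch_inf (a * b) q
      / (qpoch_inf a q ^+ 2 * qpoch_inf b q ^+ 2).
Proof.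
(* One factor [x] of [x ^+ n] goes to each factor of the product:
   [(1 - q / x * q ^+ j) * x = x - q ^+ j.+1], by [x != 0]. *)
have reciE x y n : x != 0 -> qpoch (q / x) q n * x ^+ n / qpoch y q n.+1 = reci q x y n.
  move=> x0; rewrite /reci /qpoch; congr (_ / _).
  have -> : x ^+ n = \prod_(j < n) x by rewrite prodr_const card_ord.
  rewrite -big_split/=; apply: eq_bigr => j _.
  by rewrite exprS; field.
have -> : (fun n : nat => n%:R * qpoch (q / a) q n * a ^+ n / qpoch b q n.+1
      + n.+1%:R * qpoch (q / b) q n * b ^+ n / qpoch a q n.+1)
    = (fun n => n%:R * reci q a b n + n.+1%:R * reci q b a n).
  by apply/funext => n; rewrite -!reciE// !mulrA.
have -> : qpoch_inf q q ^+ 3 * qpoch_inf (a * b) q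
      / (qpoch_inf a q ^+ 2 * qpoch_inf b q ^+ 2) = ssum q a b.
  have q_neq0 : q != 0 by rewrite -normr_gt0.
  have N : qpoch_inf a q ^+ 2 * qpoch_inf b q ^+ 2 != 0.
    by rewrite mulf_neq0 ?expf_neq0 ?qpoch_inf_neq0.
  by apply: (mulIf N); rewrite divfK// ssumE// ssum00// mulrC.
exact: (cvg_seriesD _ _ _ _ (cvg_rsum1 q q_lt1 a b a_lt1 b_lt1)
  (cvg_rsum1S q q_lt1 b a b_lt1 a_lt1)).
Qed.
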